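(* Let $\mathcal{H}:=\mathbb{C}^{2^n}\otimes\mathcal{H}_m$, let $1\le k\le 2n$, and let $\Phi:\mathcal{L}(\mathcal{H})\to\mathcal{L}(\mathcal{H})$ be a positive map. Let $E_k$ be the positive projection of $\mathcal{L}(\mathbb{C}^{2^n})$ onto the spin factor $V_k$ and $F_k$ the positive projection of $\mathcal{L}(\mathcal{H})$ onto the spin factor $V_k\otimes I_m$. Then $\Phi\in\mathcal{M}_{\{F_k\}}^\circ$ if and only if $\Phi\otimes E_k$ is positive.
   Context: $\mathcal{H}_m$ is an $m$-dimensional complex Hilbert space, and $\mathcal{L}(\cdot)$ denotes the space of linear operators. A linear map between such operator spaces is positive if it sends positive semidefinite operators to positive semidefinite operators, and completely positive if $id_r\otimes\Phi$ is positive for all $r\in\mathbb{N}$, where $id_r$ is the identity map on the $r\times r$ matrices. $\mathcal{P}_1$ and $\mathcal{CP}$ are the cones of positive and completely positive maps on $\mathcal{L}(\mathcal{H})$. Spin factors: let $\sigma_1=\begin{bmatrix}1&0\\0&-1\end{bmatrix}$, $\sigma_2=\begin{bmatrix}0&1\\1&0\end{bmatrix}$, $\sigma_3=\begin{bmatrix}0&-i\\i&0\end{bmatrix}$. In $\mathcal{L}(\mathbb{C}^{2^n})=\mathcal{L}(\mathbb{C}^2)^{\otimes n}$ set, for $1\le j\le n$, $s_{2j-1}:=\sigma_3^{\otimes(j-1)}\otimes\sigma_1\otimes I^{\otimes(n-j)}$ and $s_{2j}:=\sigma_3^{\otimes(j-1)}\otimes\sigma_2\otimes I^{\otimes(n-j)}$,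 and $s_0:=I$. The spin factor $V_k$ is the real linear span of $\{s_0,s_1,\dots,s_k\}$, and $V_k\otimes I_m$ is the span of $\{s_i\otimes I_m:0\le i\le k\}$. With $\tau$ the normalized trace ($\tau(I)=1$), the projections are $E_k(X)=\sum_{i=0}^k\tau(s_iX)s_i$ on $\mathcal{L}(\mathbb{C}^{2^n})$ and $F_k=E_k\otimes\tau'$ on $\mathcal{L}(\mathcal{H})$, where $\tau'(Y)=\tau(Y)I_m$, i.e. $F_k(Z)=\sum_{i=0}^k\tau((s_i\otimes I_m)Z)\,s_i\otimes I_m$. For a set $\mathcal{Q}$ of positive maps on $\mathcal{L}(\mathcal{H})$, the convex mapping cone generated by $\mathcal{Q}$ is $\mathcal{M}_{\mathcal{Q}}:=\{\sum_i\Phi_i\circ\Omega_i\circ\Psi_i:\Omega_i\in\mathcal{Q},\ \Phi_i,\Psi_i\in\mathcal{CP}\ \forall i\}$ (finite sums). With respect to the standard orthonormal product basis $\{e_i\}$ of $\mathcal{H}$, the Choi matrix is $C_\Phi=\sum_{i,j}e_ie_j^*\otimes\Phi(e_ie_j^* )$, and the dual cone of a cone $\mathcal{M}$ of positive maps containing all maps $X\mapsto AXA^*$ with ${\rm rank}(A)\le 1$ is $\mathcal{M}^\circ:=\{\Psi\in\mathcal{P}_1:{\rm Tr}(C_\Psi C_\Omega)\ge 0\ \text{for all}\ \Omega\in\mathcal{M}\}$. *)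

(* Defs.v *)
From HB Require Import structures.
From mathcomp Require Import all_boot all_order all_algebra.
From mathcomp Require Export classical_sets reals complex mxtens.

Set Implicit Arguments.
Unset Strict Implicit.
Unset Printing Implicit Defensive.

Import Order.TTheory GRing.Theory Num.Theory.

Local Open Scope ring_scope.
Local Open Scope classical_set_scope.

Section TensorMaps.
Variable C : numClosedFieldType.

(* The (i, j) block Z_ij of Z = \sum_(i, j) e_ij (x) Z_ij. *)
Definition tensblock (p q : nat) (Z : 'M[C]_(p * q)) (i j : 'I_p) : 'M[C]_q :=
  \matrix_(a, b) Z (mxtens_index (i, a)) (mxtens_index (j, b)).

Section Tens.
Variables p q p' q' : nat.
Variables (Phi : 'Hom('M[C]_p, 'M[C]_p')) (Psi : 'Hom('M[C]_q, 'M[C]_q')).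

Definition tensmap_fun (Z : 'M[C]_(p * q)) : 'M[C]_(p' * q') :=
  \sum_(i < p) \sum_(j < p) Phi (delta_mx i j) *t Psi (tensblock Z i j).

Fact tensmap_is_linear : linear tensmap_fun.
Proof.
move=> a Y Z; rewrite /tensmap_fun scaler_sumr -big_split /=.
apply: eq_bigr => i _; rewrite scaler_sumr -big_split /=.
apply: eq_bigr => j _.
have -> : tensblock (a *: Y + Z) i j = a *: tensblock Y i j + tensblock Z i j.
  by apply/matrixP=> s t; rewrite !mxE.
rewrite linearP; apply/matrixP=> s t; rewrite !mxE mulrDr; congr (_ + _).
by rewrite mulrCA.
Qed.

HB.instance Definition _ :=
  GRing.isLinear.Build C _ _ _ tensmap_fun tensmap_is_linear.

Definition tensmap : 'Hom('M[C]_(p * q), 'M[C]_(p' * q')) :=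
  linfun tensmap_fun.

(* Phi (x) Psi is the linear map determined by this property. *)
Lemma tensmap_tens (A : 'M[C]_p) (B : 'M[C]_q) :
  tensmap (A *t B) = Phi A *t Psi B.
Proof.
rewrite lfunE /= /tensmap_fun [in RHS](matrix_sum_delta A) linear_sum /=.
have tensD D E (F : 'M[C]_q') : (D + E : 'M[C]_p') *t F = D *t F + E *t F.
  by apply/matrixP=> s t; rewrite !mxE mulrDl.
have sumt n (G : 'I_n -> 'M[C]_p') (F : 'M[C]_q') :
    (\sum_i G i) *t F = \sum_i (G i *t F).
  by apply: (big_morph (fun D => D *t F)) => [D E|]; rewrite ?tensD ?tens0mx.
rewrite sumt; apply: eq_bigr => i _; rewrite linear_sum sumt.
apply: eq_bigr => j _; rewrite linearZ /=.
have -> : tensblock (A *t B) i j = A i j *: B.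
  by apply/matrixP=> s t; rewrite mxE tensmxE mxE.
rewrite linearZ /=; apply/matrixP=> s t; rewrite !mxE.
by rewrite mulrCA mulrA.
Qed.

End Tens.
End TensorMaps.

Section Cones.
Local Open Scope sesquilinear_scope.
Variable C : numClosedFieldType.

(* In C, 0 <= z means that z is real and nonnegative, so a matrix satisfying
   this condition is automatically Hermitian. *)
Definition psdmx (d : nat) (A : 'M[C]_d) : Prop :=
  forall v : 'cV[C]_d, 0 <= (v ^t* *m A *m v) 0 0.

Definition positive_map (p q : nat) (Phi : 'Hom('M[C]_p, 'M[C]_q)) : Prop :=
  forall X : 'M[C]_p, psdmx X -> psdmx (Phi X).

Definition completely_positive_map (p q : nat)
    (Phi : 'Hom('M[C]_p, 'M[C]_q)) : Prop :=
  forall r : nat, positive_map (tensmap (\1%VF : 'End('M[C]_r)) Phi).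

Definition P1 (d : nat) : set 'End('M[C]_d) := [set Phi | positive_map Phi].

Definition CP (d : nat) : set 'End('M[C]_d) :=
  [set Phi | completely_positive_map Phi].

Definition mapping_cone (d : nat) (Q : set 'End('M[C]_d)) :
    set 'End('M[C]_d) :=
  [set Theta | exists (r : nat) (Phi Omega Psi : 'I_r -> 'End('M[C]_d)),
     (forall i, [/\ CP (Phi i), Q (Omega i) & CP (Psi i)]) /\
     Theta = \sum_(i < r) (Phi i \o Omega i \o Psi i)%VF].

Definition choi (d : nat) (Phi : 'End('M[C]_d)) : 'M[C]_(d * d) :=
  \sum_(i < d) \sum_(j < d) delta_mx i j *t Phi (delta_mx i j).

Definition dual_cone (d : nat) (M : set 'End('M[C]_d)) : set 'End('M[C]_d) :=
  [set Psi | P1 Psi /\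
     forall Omega, M Omega -> 0 <= \tr (choi Psi *m choi Omega)].

End Cones.

Section SpinFactors.
Variable C : numClosedFieldType.

Definition sigma1 : 'M[C]_2 := \matrix_(a, b)
  (if a != b then 0 else if a == ord0 then 1 else -1).

Definition sigma2 : 'M[C]_2 := \matrix_(a, b) (if a != b then 1 else 0).

Definition sigma3 : 'M[C]_2 := \matrix_(a, b)
  (if a == b then 0 else if a == ord0 then - 'i else 'i).

(* For i > 0, uphalf i is the j with i = 2j - 1 or i = 2j.  The factors have
   total size 2 ^ (j - 1) * 2 * 2 ^ (n - j), which conform_mx identifies with
   2 ^ n; its default value 0 is only reached when i > 2n (see spinE). *)
Definition spin (n i : nat) : 'M[C]_(2 ^ n) :=
  let j := uphalf i in
  if i == 0%N then 1%:M else
  conform_mx 0 (sigma3 ^t (j - 1)%N *t (if odd i then sigma1 else sigma2)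
                  *t (1%:M : 'M[C]_(2 ^ (n - j)))).

Lemma spin_dim (n i : nat) : (0 < i <= n.*2)%N ->
  (2 ^ (uphalf i - 1) * 2 * 2 ^ (n - uphalf i) = 2 ^ n)%N.
Proof.
case/andP=> i0 lein; rewrite -expnSr -expnD; congr (2 ^ _)%N.
have j0 : (0 < uphalf i)%N by rewrite uphalf_gt0.
by rewrite subn1 prednK // subnKC // leq_uphalf_double.
Qed.

Lemma spinE (n i : nat) (hi : (0 < i <= n.*2)%N) :
  spin n i = castmx (spin_dim hi, spin_dim hi)
    (sigma3 ^t (uphalf i - 1)%N *t (if odd i then sigma1 else sigma2) *t 1%:M).
Proof.
case/andP: (hi) => i0 _.
rewrite /spin -[i == 0%N]negbK -lt0n i0 /=.
by rewrite -(conform_castmx (spin_dim hi, spin_dim hi)) conform_mx_id.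
Qed.

Definition normalized_trace (d : nat) (A : 'M[C]_d) : C := \tr A / d%:R.

Section Projection.
Variables (d : nat) (s : nat -> 'M[C]_d) (k : nat).

Definition span_proj_fun (X : 'M[C]_d) : 'M[C]_d :=
  \sum_(i < k.+1) normalized_trace (s i *m X) *: s i.

Fact span_proj_is_linear : linear span_proj_fun.
Proof.
move=> a X Y; rewrite /span_proj_fun scaler_sumr -big_split /=.
apply: eq_bigr => i _; rewrite scalerA -scalerDl; congr (_ *: _).
by rewrite /normalized_trace mulmxDr -scalemxAr mxtraceD mxtraceZ mulrDl mulrA.
Qed.

HB.instance Definition _ :=
  GRing.isLinear.Build C _ _ _ span_proj_fun span_proj_is_linear.

Definition span_proj : 'End('M[C]_d) := linfun span_proj_fun.

End Projection.

Definition spin_amp (n m i : nat) : 'M[C]_(2 ^ n * m) :=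
  spin n i *t (1%:M : 'M[C]_m).

Definition Eproj (n k : nat) : 'End('M[C]_(2 ^ n)) := span_proj (spin n) k.

Definition Fproj (n m k : nat) : 'End('M[C]_(2 ^ n * m)) :=
  span_proj (spin_amp n m) k.

End SpinFactors.

(* Main.v *)
(* The pairing of the Choi matrices of Phi and X |-> A F_k(B X B^* ) A^* is, up to a
   positive factor, the sum over i <= k of
     tr (Phi (B^* S_i B) (A S_i A^* )),  S_i = s_i (x) I_m,
   while <y| (Phi (x) E_k)(x x^* ) |y> is, up to a positive factor, the same kind of sum
     tr (Phi (X s_i^T X^* ) (Y s_i^T Y^* )),
   X and Y being the matrices of coordinates of x and y.  By Choi's theorem every
   completely positive map is a sum of conjugations, so each side of the equivalence
   says that the corresponding sums are nonnegative.  Cutting A and B^* into m column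
   blocks replaces S_i by s_i, and s_i^T = +- s_i, where the sign disappears because s_i
   occurs twice in each term. *)
Require Import Defs.
From mathcomp Require Import all_boot all_order all_algebra.

Import GRing.Theory Num.Theory.

Local Open Scope ring_scope.
Local Open Scope classical_set_scope.

(** * Kronecker products, blocks, and vectors written as coordinate matrices *)

Section Matrices.
Local Open Scope sesquilinear_scope.
Context {C : numClosedFieldType}.

Lemma adjmxM {m n p : nat} (A : 'M[C]_(m, n)) (B : 'M[C]_(n, p)) :
  (A *m B) ^t* = B ^t* *m A ^t*.
Proof. by rewrite trmx_mul map_mxM. Qed.

Lemma adjmx_tens {m n p q : nat} (A : 'M[C]_(m, n)) (B : 'M[C]_(p, q)) :
  (A *t B) ^t* = A ^t* *t B ^t*.
Proof. by apply/matrixP => i j; rewrite !mxE rmorphM. Qed.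

Lemma big_mxtens {V : nmodType} {p q : nat} (F : 'I_(p * q) -> V) :
  \sum_u F u = \sum_(i < p) \sum_(a < q) F (mxtens_index (i, a)).
Proof.
rewrite pair_big /= (reindex (@mxtens_index p q)) /=.
  by apply: eq_bigr => -[].
by exists (@mxtens_unindex p q) => u _; rewrite (mxtens_indexK, mxtens_unindexK).
Qed.

Lemma tensmx_suml {I : Type} {r : seq I} {m n p q : nat}
    (A : I -> 'M[C]_(m, n)) (B : 'M[C]_(p, q)) :
  (\sum_(i <- r) A i) *t B = \sum_(i <- r) (A i *t B).
Proof.
apply/matrixP => i j; rewrite mxE !summxE mulr_suml.
by apply: eq_bigr => k _; rewrite mxE.
Qed.

Lemma tensmx_sumr {I : Type} {r : seq I} {m n p q : nat}
    (A : 'M[C]_(m, n)) (B : I -> 'M[C]_(p, q)) :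
  A *t (\sum_(i <- r) B i) = \sum_(i <- r) (A *t B i).
Proof.
apply/matrixP => i j; rewrite mxE !summxE mulr_sumr.
by apply: eq_bigr => k _; rewrite mxE.
Qed.

Lemma tensmxZl {m n p q : nat} (c : C) (A : 'M[C]_(m, n)) (B : 'M[C]_(p, q)) :
  (c *: A) *t B = c *: (A *t B).
Proof. by apply/matrixP => i j; rewrite !mxE mulrA. Qed.

Lemma tensmxZr {m n p q : nat} (c : C) (A : 'M[C]_(m, n)) (B : 'M[C]_(p, q)) :
  A *t (c *: B) = c *: (A *t B).
Proof. by apply/matrixP => i j; rewrite !mxE mulrCA. Qed.

Lemma mxtrace_tens {p q : nat} (A : 'M[C]_p) (B : 'M[C]_q) :
  \tr (A *t B) = \tr A * \tr B.
Proof.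
rewrite /mxtrace big_mxtens mulr_suml; apply: eq_bigr => i _.
by rewrite mulr_sumr; apply: eq_bigr => a _; rewrite tensmxE.
Qed.

Lemma mxtrace_delta_mul {d : nat} (A : 'M[C]_d) (a b : 'I_d) :
  \tr (A *m delta_mx b a) = A a b.
Proof.
rewrite /mxtrace (bigD1 a) //= big1 ?addr0 => [|i /negPf nia].
  rewrite mxE (bigD1 b) //= big1 ?addr0 => [|j /negPf njb].
    by rewrite mxE !eqxx mulr1.
  by rewrite mxE njb mulr0.
by rewrite mxE big1 // => j _; rewrite mxE nia andbF mulr0.
Qed.

Lemma tensblock_sum_delta {p q : nat} (G : 'I_p -> 'I_p -> 'M[C]_q) (i j : 'I_p) :
  tensblock (\sum_k \sum_l delta_mx k l *t G k l) i j = G i j.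
Proof.
apply/matrixP => a b; rewrite mxE summxE (bigD1 i) //= summxE (bigD1 j) //=.
rewrite !big1 ?addr0.
- by rewrite tensmxE mxE !eqxx mul1r.
- move=> k nki; rewrite summxE big1 // => l _.
  by rewrite tensmxE mxE [i == k]eq_sym (negPf nki) mul0r.
- by move=> l nlj; rewrite tensmxE mxE [j == l]eq_sym (negPf nlj) andbF mul0r.
Qed.

Lemma tensblock_sum {p q : nat} (Z : 'M[C]_(p * q)) :
  Z = \sum_i \sum_j delta_mx i j *t tensblock Z i j.
Proof.
apply/matrixP => u v; case: (mxtens_indexP u) => i a {u}.
case: (mxtens_indexP v) => j b {v}.
by have /matrixP/(_ a b) := tensblock_sum_delta (tensblock Z) i j; rewrite !mxE.
Qed.

(* The vector of C^p (x) C^q with coordinates X i a on e_i (x) e_a. *)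
Definition vecmx {p q : nat} (X : 'M[C]_(p, q)) : 'cV[C]_(p * q) :=
  \col_u X (mxtens_unindex u).1 (mxtens_unindex u).2.

Lemma vecmxE {p q : nat} (X : 'M[C]_(p, q)) i a z :
  vecmx X (mxtens_index (i, a)) z = X i a.
Proof. by rewrite mxE mxtens_indexK. Qed.

Lemma vecmx_surj {p q : nat} (x : 'cV[C]_(p * q)) :
  exists X : 'M[C]_(p, q), x = vecmx X.
Proof.
exists (\matrix_(i, a) x (mxtens_index (i, a)) 0).
by apply/colP => u; rewrite !mxE -surjective_pairing mxtens_unindexK.
Qed.

(** The second tensor factor acts on the column index of [Y], hence from the right and
    transposed. *)
Lemma tensmx_vecmx {p q : nat} (P : 'M[C]_p) (S : 'M[C]_q) (Y : 'M[C]_(p, q)) :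
  (P *t S) *m vecmx Y = vecmx (P *m Y *m S^T).
Proof.
apply/colP => u; case: (mxtens_indexP u) => i a {u}.
rewrite vecmxE mxE big_mxtens exchange_big mxE /=; apply: eq_bigr => b _.
rewrite !mxE mulr_suml; apply: eq_bigr => j _.
by rewrite tensmxE vecmxE mulrAC.
Qed.

Lemma vecmx_dot {p q : nat} (Y Z : 'M[C]_(p, q)) :
  ((vecmx Y) ^t* *m vecmx Z) 0 0 = \tr (Y ^t* *m Z).
Proof.
rewrite mxE big_mxtens exchange_big; apply: eq_bigr => a _.
by rewrite mxE; apply: eq_bigr => i _; rewrite !mxE !mxtens_indexK.
Qed.

(** As a function of the matrix unit, a block of a rank-one matrix is a conjugation. This yields
    both the Kraus operators and the value of Phi (x) E_k on rank-one inputs. *)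
Lemma tensblock_vecmx {p q : nat} (X : 'M[C]_(p, q)) (i j : 'I_p) :
  tensblock (vecmx X *m (vecmx X) ^t*) i j = X^T *m delta_mx i j *m (X^T) ^t*.
Proof.
apply/matrixP => a b; rewrite !mxE big_ord1 !mxE !mxtens_indexK /=.
rewrite (bigD1 j) //= big1 ?addr0 => [|l /negPf nlj].
  rewrite !mxE (bigD1 i) //= big1 ?addr0 => [|l /negPf nli].
    by rewrite !mxE !eqxx mulr1.
  by rewrite !mxE nli mulr0.
by rewrite !mxE big1 ?mul0r // => h _; rewrite !mxE nlj andbF mulr0.
Qed.

End Matrices.

(** * Positive semidefinite matrices as sums of rank-one matrices *)

Section PositiveSemidefinite.
Local Open Scope sesquilinear_scope.
Context {C : numClosedFieldType}.

Lemma psdmx_conj {m n : nat} (A : 'M[C]_(m, n)) (Z : 'M[C]_n) :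
  psdmx Z -> psdmx (A *m Z *m A ^t*).
Proof.
by move=> Zge0 v; have := Zge0 (A ^t* *m v); rewrite adjmxM trmxCK !mulmxA.
Qed.

Lemma psdmx_sum {I : Type} {r : seq I} {d : nat} (A : I -> 'M[C]_d) :
  (forall i, psdmx (A i)) -> psdmx (\sum_(i <- r) A i).
Proof.
move=> Age0 v; rewrite mulmx_sumr mulmx_suml summxE.
by apply: sumr_ge0 => i _; apply: Age0.
Qed.

Lemma psdmx_rank1 {d : nat} (v : 'cV[C]_d) : psdmx (v *m v ^t*).
Proof.
rewrite -[v in v *m _]mulmx1; apply: psdmx_conj => z.
rewrite mulmx1 mxE; apply: sumr_ge0 => i _.
by rewrite !mxE mulrC mul_conjC_ge0.
Qed.

(** Complex polarization, with test vectors e_i + c e_j. *)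
Lemma quad_form_eq0 {d : nat} (M : 'M[C]_d) :
  (forall v : 'cV_d, (v ^t* *m M *m v) 0 0 = 0) -> M = 0.
Proof.
move=> M0; pose e i : 'cV[C]_d := delta_mx i 0.
have eME i j : ((e i) ^t* *m M *m e j) 0 0 = M i j.
  by rewrite trmx_delta map_delta_mx -rowE -colE !mxE.
have polar i j (c : C) : c * M i j + c^* * M j i = 0.
  have := M0 (e i + c *: e j).
  have -> : (e i + c *: e j) ^t* = (e i) ^t* + c^* *: (e j) ^t*.
    by apply/matrixP => a b; rewrite !mxE rmorphD rmorphM.
  have entryD (A B : 'M[C]_1) : (A + B) 0 0 = A 0 0 + B 0 0 by rewrite mxE.
  have entryZ b (A : 'M[C]_1) : (b *: A) 0 0 = b * A 0 0 by rewrite mxE.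
  rewrite !mulmxDl !mulmxDr -!scalemxAl -!scalemxAr !(entryD, entryZ) !eME.
  have := M0 (e i); have := M0 (e j); rewrite !eME => -> ->.
  by rewrite add0r !mulr0 addr0.
apply/matrixP => i j; rewrite [RHS]mxE.
(* The choice c = 1 gives M_ij = - M_ji, and c = i gives M_ij = M_ji. *)
have := polar i j 1; rewrite rmorph1 !mul1r => /eqP; rewrite addr_eq0 => /eqP Mij.
have := polar i j 'i; rewrite conjCi mulNr -mulrBr => /eqP.
rewrite mulf_eq0 (negPf (neq0Ci C)) /= Mij -opprD oppr_eq0 -mulr2n mulrn_eq0 /=.
by move=> /eqP ->; rewrite oppr0.
Qed.

(** The quadratic form of [A] is real, so that of A^* - A vanishes. *)
Lemma psdmx_hermitian {d : nat} {A : 'M[C]_d} : psdmx A -> A ^t* = A.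
Proof.
move=> Age0; apply/eqP; rewrite -subr_eq0; apply/eqP/quad_form_eq0 => v.
have -> : v ^t* *m (A ^t* - A) *m v = (v ^t* *m A *m v) ^t* - v ^t* *m A *m v.
  by rewrite mulmxBr mulmxBl !adjmxM trmxCK mulmxA.
have := Age0 v; move: (_ *m v) => B Bge0.
by rewrite !mxE geC0_conj // subrr.
Qed.

(** Spectral theorem: the vectors are the eigenvectors, that is the columns of P^*, scaled by the
    square roots of the eigenvalues. *)
Lemma psdmx_rank1_sum {d : nat} {A : 'M[C]_d} : psdmx A ->
  exists v : 'I_d -> 'cV[C]_d, A = \sum_i v i *m (v i) ^t*.
Proof.
move=> Age0; have Aherm := psdmx_hermitian Age0.
have /orthomx_spectralP : A \is normalmx by apply/normalmxP; rewrite Aherm.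
set P := spectralmx A; set D := spectral_diag A.
have Punit : P \is unitarymx := spectral_unitarymx A.
rewrite invmx_unitary // => AE.
have Dge0 i : 0 <= D 0 i.
  (* Testing [A] on its i-th eigenvector returns the i-th eigenvalue. *)
  have := Age0 (P ^t* *m delta_mx i 0).
  rewrite [in X in 0 <= X -> _]AE adjmxM trmxCK !mulmxA.
  rewrite !mulmxtVK //.
  by rewrite trmx_delta map_delta_mx -rowE -colE !mxE eqxx.
exists (fun i => sqrtC (D 0 i) *: col i (P ^t*)).
rewrite [LHS]AE; apply/matrixP => a b.
rewrite summxE mul_mx_diag mxE; apply: eq_bigr => i _.
rewrite !mxE big_ord1 !mxE rmorphM /= conjCK [(sqrtC _)^*]geC0_conj ?sqrtC_ge0 //.
by rewrite mulrACA -expr2 sqrtCK mulrCA mulrA.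
Qed.

End PositiveSemidefinite.

(** * Completely positive maps as sums of conjugations *)

Section Kraus.
Local Open Scope sesquilinear_scope.
Context {C : numClosedFieldType} {d : nat}.

Definition conjugation (A : 'M[C]_d) : 'End('M[C]_d) :=
  linfun (mulmxr (A ^t*) \o mulmx A).

Lemma conjugationE (A Z : 'M[C]_d) : conjugation A Z = A *m Z *m A ^t*.
Proof. by rewrite lfunE. Qed.

(** Tensoring with the identity map turns conjugation by [A] into conjugation by 1 (x) A. *)
Lemma conjugation_CP (A : 'M[C]_d) : CP (conjugation A).
Proof.
move=> r Z Zge0.
suff -> : tensmap (\1%VF : 'End('M[C]_r)) (conjugation A) Z =
    (1%:M *t A) *m Z *m (1%:M *t A) ^t*.
  exact: psdmx_conj.
rewrite lfunE [in RHS](tensblock_sum Z) mulmx_sumr mulmx_suml.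
apply: eq_bigr => i _; rewrite mulmx_sumr mulmx_suml; apply: eq_bigr => j _.
rewrite id_lfunE conjugationE adjmx_tens !tensmx_mul trmx1 map_mx1.
by rewrite mul1mx mulmx1.
Qed.

(** [vecmx 1%:M] is the unnormalized maximally entangled vector, so complete positivity at r = d
    makes the Choi matrix positive semidefinite. *)
Lemma choi_tensmap (Phi : 'End('M[C]_d)) :
  choi Phi = tensmap (\1%VF : 'End('M[C]_d)) Phi
               (vecmx 1%:M *m (vecmx 1%:M) ^t*).
Proof.
rewrite lfunE; apply: eq_bigr => i _; apply: eq_bigr => j _.
by rewrite id_lfunE tensblock_vecmx trmx1 trmx1 map_mx1 mul1mx mulmx1.
Qed.

(* Choi's theorem: reshaping a rank-one decomposition of the Choi matrix. *)
Lemma CP_kraus {Phi : 'End('M[C]_d)} : CP Phi ->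
  exists (N : nat) (A : 'I_N -> 'M[C]_d), Phi = \sum_l conjugation (A l).
Proof.
move=> PhiCP; have : psdmx (choi Phi).
  by rewrite choi_tensmap; apply/PhiCP/psdmx_rank1.
case/psdmx_rank1_sum => v choiE.
(* Boolean equality lets [xchoose] select the coordinate matrices. *)
have vE l : exists X : 'M[C]_d, v l == vecmx X.
  by have [X /eqP] := vecmx_surj (v l); exists X.
exists (d * d)%N, (fun l => (xchoose (vE l))^T); apply/lfunP => Z.
rewrite sum_lfunE (matrix_sum_delta Z) linear_sum.
under [RHS]eq_bigr do rewrite linear_sum.
rewrite exchange_big; apply: eq_bigr => a _.
rewrite linear_sum; under [RHS]eq_bigr do rewrite linear_sum.
rewrite exchange_big; apply: eq_bigr => b _.
under [RHS]eq_bigr do rewrite linearZ.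
rewrite linearZ -scaler_sumr; congr (_ *: _).
(* Both sides are now compared on a single matrix unit, whose image under [Phi] is the (a, b) block
   of the Choi matrix. *)
rewrite -[LHS](tensblock_sum_delta (fun i j => Phi (delta_mx i j))).
rewrite -[X in tensblock X]/(choi Phi) choiE.
transitivity (\sum_l tensblock (v l *m (v l) ^t*) a b).
  apply/matrixP => i j; rewrite !mxE !summxE.
  by apply: eq_bigr => l _; rewrite [RHS]mxE.
apply: eq_bigr => l _ /=; rewrite conjugationE {1 2}(eqP (xchooseP (vE l))).
exact: tensblock_vecmx.
Qed.

End Kraus.

(** * Reduction of both sides of the equivalence to sums of traces *)

Section SpanProjection.
Local Open Scope sesquilinear_scope.
Context {C : numClosedFieldType}.

(** [D] and [d] are separate because [X] and [Y] are square on the dual cone side, but have only 2^n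
    columns on the side of Phi (x) E_k. *)
Definition span_form {D d : nat} (s : nat -> 'M[C]_d) (k : nat)
    (Phi : 'End('M[C]_D)) (X Y : 'M[C]_(D, d)) : C :=
  \sum_(i < k.+1) \tr (Phi (X *m s i *m X ^t*) *m (Y *m s i *m Y ^t*)).

Lemma mxtrace_choi {d : nat} (Phi Omega : 'End('M[C]_d)) :
  \tr (choi Phi *m choi Omega) =
  \sum_a \sum_b \tr (Phi (delta_mx a b) *m Omega (delta_mx b a)).
Proof.
rewrite mulmx_suml raddf_sum; apply: eq_bigr => a _ /=.
rewrite mulmx_suml raddf_sum; apply: eq_bigr => b _ /=.
rewrite mulmx_sumr raddf_sum (bigD1 b) //= mulmx_sumr raddf_sum (bigD1 a) //=.
rewrite !big1 ?addr0.
- rewrite tensmx_mul mxtrace_tens mul_delta_mx -[delta_mx a a]mul1mx.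
  by rewrite mxtrace_delta_mul mxE eqxx mul1r.
- move=> c ncb; rewrite mulmx_sumr raddf_sum big1 // => e _ /=.
  by rewrite tensmx_mul mxtrace_tens mul_delta_mx_0 1?eq_sym // mxtrace0 mul0r.
- move=> e nea; rewrite tensmx_mul mxtrace_tens mxtrace_delta_mul mxE.
  by rewrite (negPf nea) mul0r.
Qed.

Lemma choi_sum {d : nat} {I : Type} {r : seq I} (Phi : I -> 'End('M[C]_d)) :
  choi (\sum_(i <- r) Phi i) = \sum_(i <- r) choi (Phi i).
Proof.
rewrite exchange_big; apply: eq_bigr => a _; rewrite exchange_big.
by apply: eq_bigr => b _; rewrite sum_lfunE tensmx_sumr.
Qed.

Lemma span_projE {d : nat} (s : nat -> 'M[C]_d) (k : nat) (X : 'M[C]_d) :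
  span_proj s k X = \sum_(i < k.+1) normalized_trace (s i *m X) *: s i.
Proof. by rewrite lfunE. Qed.

(** The normalized trace of s_i B E_ba B^* is, up to 1/d, the (a, b) entry of B^* s_i B; summing
    over a and b rebuilds that matrix inside [Phi]. *)
Lemma mxtrace_choi_span_proj {d : nat} (s : nat -> 'M[C]_d) (k : nat)
    (Phi : 'End('M[C]_d)) (A B : 'M[C]_d) :
  \tr (choi Phi *m
       choi (conjugation A \o span_proj s k \o conjugation B)%VF) =
  d%:R^-1 * span_form s k Phi (B ^t*) A.
Proof.
rewrite mxtrace_choi mulr_sumr.
under eq_bigr => a _ do under eq_bigr => b _ do
  rewrite !comp_lfunE span_projE linear_sum mulmx_sumr raddf_sum.
under eq_bigr do rewrite exchange_big; rewrite exchange_big.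
apply: eq_bigr => i _; rewrite trmxCK.
rewrite [in RHS](matrix_sum_delta (B ^t* *m _ *m _)) linear_sum mulmx_suml.
rewrite raddf_sum mulr_sumr; apply: eq_bigr => a _ /=.
rewrite linear_sum mulmx_suml raddf_sum mulr_sumr; apply: eq_bigr => b _ /=.
rewrite !linearZ /= -scalemxAl !mxtraceZ !conjugationE.
rewrite /normalized_trace mulmxA mxtrace_mulC !mulmxA mxtrace_delta_mul.
by rewrite mulrA [_^-1 * _]mulrC.
Qed.

(** Conjugations are completely positive, so each form is a pairing with an element of the cone;
    conversely, Kraus decompositions expand any pairing into such forms. *)
Lemma dual_cone_span_proj {d : nat} (s : nat -> 'M[C]_d) (k : nat)
    (Phi : 'End('M[C]_d)) :
  positive_map Phi ->
  dual_cone (mapping_cone [set span_proj s k]) Phi <->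
  forall X Y : 'M[C]_d, 0 <= span_form s k Phi X Y.
Proof.
move=> Phi_pos; split=> [[_ Phi_dual] X Y | form_ge0].
  (* For d = 0 the factor 1/d is 0 and cannot be cancelled, but all traces are empty sums. *)
  case: (posnP d) => [d0 | d_gt0].
    apply: sumr_ge0 => i _; apply: sumr_ge0 => -[j jd] _.
    by exfalso; move: jd; rewrite d0.
  have := Phi_dual (conjugation Y \o span_proj s k \o conjugation (X ^t*))%VF.
  rewrite mxtrace_choi_span_proj trmxCK pmulr_rge0 ?invr_gt0 ?ltr0n //; apply.
  exists 1%N, (fun=> conjugation Y), (fun=> span_proj s k),
    (fun=> conjugation (X ^t*)).
  by split=> [_|]; [split=> //; apply: conjugation_CP | rewrite big_ord1].
split=> // _ [r [F [G [H [FGH ->]]]]].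
rewrite choi_sum mulmx_sumr raddf_sum; apply: sumr_ge0 => i _ /=.
have [/CP_kraus [M [A ->]] -> /CP_kraus [N [B ->]]] := FGH i.
have -> : ((\sum_l conjugation (A l)) \o span_proj s k \o
    (\sum_l conjugation (B l)))%VF =
    \sum_l \sum_h (conjugation (A l) \o span_proj s k \o conjugation (B h))%VF.
  apply/lfunP => Z; rewrite !comp_lfunE !sum_lfunE; apply: eq_bigr => l _.
  rewrite sum_lfunE !linear_sum; apply: eq_bigr => h _.
  by rewrite !comp_lfunE.
rewrite choi_sum mulmx_sumr raddf_sum; apply: sumr_ge0 => l _ /=.
rewrite choi_sum mulmx_sumr raddf_sum; apply: sumr_ge0 => h _ /=.
by rewrite mxtrace_choi_span_proj mulr_ge0 ?invr_ge0 ?ler0n.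
Qed.

(** One transpose arises when the trace of s_i against the (a, b) block is read as the (a, b) entry
    of X s_i^T X^*, the other when s_i acts on the coordinate matrix [Y]. *)
Lemma tensmap_span_proj_form {D d : nat} (s : nat -> 'M[C]_d) (k : nat)
    (Phi : 'End('M[C]_D)) (X Y : 'M[C]_(D, d)) :
  ((vecmx Y) ^t* *m
    tensmap Phi (span_proj s k) (vecmx X *m (vecmx X) ^t*) *m vecmx Y) 0 0 =
  d%:R^-1 * span_form (fun i => (s i)^T) k Phi X Y.
Proof.
have -> : tensmap Phi (span_proj s k) (vecmx X *m (vecmx X) ^t*) =
    \sum_(i < k.+1) d%:R^-1 *: (Phi (X *m (s i)^T *m X ^t*) *t s i).
  rewrite lfunE /= /tensmap_fun.
  under [LHS]eq_bigr => a _ do under eq_bigr => b _ do rewrite span_projE tensmx_sumr.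
  under [LHS]eq_bigr do rewrite exchange_big; rewrite exchange_big.
  apply: eq_bigr => i _; rewrite [in RHS](matrix_sum_delta (X *m _ *m _)).
  rewrite linear_sum tensmx_suml scaler_sumr; apply: eq_bigr => a _.
  rewrite linear_sum tensmx_suml scaler_sumr; apply: eq_bigr => b _.
  rewrite linearZ /= tensmxZl tensmxZr scalerA; congr (_ *: _).
  rewrite mulrC; congr (_ / _); rewrite tensblock_vecmx.
  rewrite mulmxA mxtrace_mulC !mulmxA mxtrace_delta_mul.
  transitivity (((X^T) ^t* *m s i *m X^T)^T a b); first by rewrite [RHS]mxE.
  by rewrite !trmx_mul !trmxK map_trmx mulmxA.
rewrite mulmx_sumr mulmx_suml summxE mulr_sumr; apply: eq_bigr => i _.
rewrite -scalemxAr -scalemxAl mxE -[_ *m _ *m vecmx Y]mulmxA tensmx_vecmx.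
rewrite vecmx_dot; congr (_ * _).
by rewrite mxtrace_mulC !mulmxA.
Qed.

(** By linearity, positivity need only be tested on rank-one inputs. *)
Lemma positive_tensmap_span_proj {D d : nat} (s : nat -> 'M[C]_d) (k : nat)
    (Phi : 'End('M[C]_D)) :
  (0 < d)%N ->
  positive_map (tensmap Phi (span_proj s k)) <->
  forall X Y : 'M[C]_(D, d), 0 <= span_form (fun i => (s i)^T) k Phi X Y.
Proof.
move=> d_gt0; have Vd_ge0 z : (0 <= d%:R^-1 * z :> C) = (0 <= z).
  by rewrite pmulr_rge0 ?invr_gt0 ?ltr0n.
split=> [pos X Y | form_ge0 Z /psdmx_rank1_sum [v ->]].
  by rewrite -Vd_ge0 -tensmap_span_proj_form; apply/pos/psdmx_rank1.
rewrite linear_sum; apply: psdmx_sum => i y.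
have [[X ->] [Y ->]] := (vecmx_surj (v i), vecmx_surj y).
by rewrite tensmap_span_proj_form Vd_ge0.
Qed.

Lemma span_form_signs {D d : nat} (s t : nat -> 'M[C]_d) (k : nat)
    (Phi : 'End('M[C]_D)) (X Y : 'M[C]_(D, d)) :
  (forall i, exists b : bool, t i = (-1) ^+ b *: s i) ->
  span_form t k Phi X Y = span_form s k Phi X Y.
Proof.
move=> tE; apply: eq_bigr => i _; have [b ->] := tE i.
have conjZ c (W : 'M[C]_(D, d)) :
    W *m (c *: s i) *m W ^t* = c *: (W *m s i *m W ^t*).
  by rewrite -scalemxAr -scalemxAl.
rewrite !conjZ [Phi _]linearZ -scalemxAl -scalemxAr scalerA.
by rewrite -expr2 sqrr_sign scale1r.
Qed.

(** S (x) 1 does not mix columns of [A] with different second index j, so each j contributes its own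
    block of q columns. *)
Lemma tens1_conj {D q m : nat} (A : 'M[C]_(D, q * m)) (S : 'M[C]_q) :
  A *m (S *t 1%:M) *m A ^t* =
  \sum_(j < m) (\matrix_(p, a) A p (mxtens_index (a, j))) *m S *m
               (\matrix_(p, a) A p (mxtens_index (a, j))) ^t*.
Proof.
apply/matrixP => p p'; rewrite summxE mxE big_mxtens exchange_big.
apply: eq_bigr => j _; rewrite mxE; apply: eq_bigr => b _.
rewrite !mxE; congr (_ * _); rewrite big_mxtens; apply: eq_bigr => a _.
rewrite (bigD1 j) //= big1 ?addr0 => [|l /negPf nlj].
  by rewrite tensmxE !mxE eqxx mulr1.
by rewrite tensmxE !mxE nlj !mulr0.
Qed.

Lemma span_form_tens1 {D q m : nat} (s : nat -> 'M[C]_q) (k : nat)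
    (Phi : 'End('M[C]_D)) :
  (0 < m)%N ->
  (forall A B : 'M[C]_(D, q * m),
     0 <= span_form (fun i => s i *t 1%:M) k Phi A B) <->
  (forall X Y : 'M[C]_(D, q), 0 <= span_form s k Phi X Y).
Proof.
move=> m_gt0; split=> [form_ge0 X Y | form_ge0 A B].
  (* [Z] becomes the column block of index 0, and the other blocks are zero. *)
  pose pad (Z : 'M[C]_(D, q)) : 'M[C]_(D, q * m) :=
    \matrix_(p, u)
      (Z p (mxtens_unindex u).1 *+ ((mxtens_unindex u).2 == Ordinal m_gt0)).
  have padE Z i : pad Z *m (s i *t 1%:M) *m (pad Z) ^t* = Z *m s i *m Z ^t*.
    rewrite tens1_conj (bigD1 (Ordinal m_gt0)) //= big1 ?addr0 => [|j /negPf nj0].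
      set W := \matrix_(_, _) _; suff -> : W = Z by [].
      by apply/matrixP => p a; rewrite !mxE mxtens_indexK eqxx.
    set W := \matrix_(_, _) _; suff -> : W = 0 by rewrite !mul0mx.
    by apply/matrixP => p a; rewrite !mxE mxtens_indexK nj0.
  have := form_ge0 (pad X) (pad Y); rewrite /span_form.
  by under eq_bigr do rewrite !padE.
rewrite /span_form; under eq_bigr => i _.
  rewrite !tens1_conj [Phi _]linear_sum mulmx_suml raddf_sum /=.
  under eq_bigr do rewrite mulmx_sumr raddf_sum /=.
  over.
(* For each block j of [A] and l of [B], the inner sum over i is a form for [s] itself. *)
rewrite exchange_big; apply: sumr_ge0 => j _.
by rewrite exchange_big; apply: sumr_ge0 => l _; apply: form_ge0.
Qed.

End SpanProjection.

(** * Transposes of the spin generators *)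

Section SpinTranspose.
Context {C : numClosedFieldType}.

Lemma trmx_sigma3 : (sigma3 C)^T = - sigma3 C.
Proof.
by apply/matrixP => -[[|[|]]//= ?] [[|[|]]//= ?]; rewrite !mxE /= ?oppr0 ?opprK.
Qed.

Lemma trmx_ntensmx {m : nat} (A : 'M[C]_m) (k : nat) (b : bool) :
  A^T = (-1) ^+ b *: A -> exists c : bool, (A ^t k)^T = (-1) ^+ c *: A ^t k.
Proof.
(* The recursion of [^t] ends at one factor, so the power 0 is treated apart and the induction
   starts at 1. *)
case: k => [|k] AT; first by exists false; rewrite ntensmx0 scale1r trmx1.
elim: k => [|k [c IHk]]; first by exists b.
exists (b (+) c); rewrite ntensmxSS trmx_tens AT IHk tensmxZl tensmxZr scalerA.
by rewrite signr_addb.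
Qed.

(** [sigma1], [sigma2] and the identity are symmetric and [sigma3] is antisymmetric, so only the
    leading [sigma3] factors contribute a sign. *)
Lemma trmx_spin (n i : nat) :
  exists b : bool, (spin C n i)^T = (-1) ^+ b *: spin C n i.
Proof.
rewrite /spin; case: (i == 0%N); first by exists false; rewrite trmx1 scale1r.
have [|b sigma3T] := trmx_ntensmx (sigma3 C) (uphalf i - 1)%N true.
  by rewrite trmx_sigma3 scaleN1r.
exists b; rewrite trmx_conform trmx0 !trmx_tens trmx1 sigma3T.
have -> : (if odd i then sigma1 C else sigma2 C)^T =
    if odd i then sigma1 C else sigma2 C.
  apply/matrixP => a c; rewrite mxE; case: (odd i); rewrite !mxE eq_sym //.
  by case: eqP => // ->.
rewrite !tensmxZl.
(* If the sizes disagree, [conform_mx] returns its default 0, which any sign fixes. *)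
have [E|neq] := eqVneq (2 ^ (uphalf i - 1) * 2 * 2 ^ (n - uphalf i))%N (2 ^ n)%N.
  by move: (_ *t _ *t _); rewrite E => M; rewrite !conform_mx_id.
by rewrite !nonconform_mx ?neq // scaler0.
Qed.

End SpinTranspose.

Theorem theorem21 (R : realType) (n m k : nat)
    (Phi : 'End('M[R[i]]_(2 ^ n * m))) :
  (1 <= k <= 2 * n)%N ->
  positive_map Phi ->
  dual_cone (mapping_cone [set Fproj R[i] n m k]) Phi <->
  positive_map (tensmap Phi (Eproj R[i] n k)).
Proof.
move=> _ Phi_pos; apply: (iff_trans (dual_cone_span_proj _ _ _ Phi_pos)).
apply: iff_sym; apply: (iff_trans (positive_tensmap_span_proj _ _ _ _)).
  by rewrite expn_gt0.
transitivity (forall X Y, 0 <= span_form (spin R[i] n) k Phi X Y).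
  by split=> form_ge0 X Y; have := form_ge0 X Y;
    rewrite (span_form_signs (spin R[i] n)) // => i; apply: trmx_spin.
(* For m = 0 there is no block to pad into; the space is zero and both forms are sums of empty
   traces. *)
case: (posnP m) => [m0 | m_gt0].
  split=> _ X Y; apply: sumr_ge0 => i _; apply: sumr_ge0 => -[j ltj] _;
    by exfalso; move: ltj; rewrite m0 muln0.
exact: iff_sym (span_form_tens1 _ _ _ m_gt0).
Qed.
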